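(* Let $\mu$ be a probability measure satisfying a Gaussian concentration bound with some constant $C>0$, i.e. $\mathbb{E}_\mu[e^{f-\mathbb{E}_\mu[f]}]\le e^{C\|\underline{\delta}(f)\|_2^2}$ for all $f\in\mathcal{L}$. Then this bound remains true, with the same constant $C$, for all $f\in\mathrm{UC}(A^{\mathbb{N}})\cap\mathrm{BC}(A^{\mathbb{N}})$ such that $\|\underline{\delta}(f)\|_2<+\infty$.
   Context: $A$ is a countable set with the discrete topology; $\mathbb{N}=\{0,1,2,\dots\}$; $A^{\mathbb{N}}$ has the product topology. $\mu$ is a probability measure on $A^{\mathbb{N}}$ or on $A^{\mathbb{Z}}$ (functions on $A^{\mathbb{N}}$ are viewed as functions on $A^{\mathbb{Z}}$ of the coordinates $\ge 0$). For $f:A^{n+1}\to\mathbb{R}$ (resp. $f:A^{\mathbb{N}}\to\mathbb{R}$) and $0\le j\le n$ (resp. $j\ge0$), $\delta_j(f)$ is the supremum of $|f(\omega)-f(\omega')|$ over pairs $\omega,\omega'$ in the domain of $f$ which coincide at all coordinates except possibly coordinate $j$; $\|\underline{\delta}(f)\|_2^2=\sum_{j}\delta_j(f)^2$. $\mathcal{L}=\bigcup_{n\ge0}\{f:A^{n+1}\to\mathbb{R}:\delta_j(f)<\infty,\ j=0,\dots,n\}$, each $f$ being viewed as a function of the coordinates $0,\dots,n$. $\mathrm{BC}(A^{\mathbb{N}})$ is the set of bounded continuous real functions on $A^{\mathbb{N}}$, and $\mathrm{UC}(A^{\mathbb{N}})$ the set of uniformly continuous ones, i.e. those with $\mathrm{var}_n(f)=\sup\{|f(\omega)-f(\omega')|:\omega_i=\omega'_i,\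 i=0,\dots,n\}\to0$ as $n\to\infty$. *)

(* Defs.v *)
From mathcomp Require Import all_boot all_order all_algebra.
From mathcomp Require Import all_classical all_reals all_analysis.

Set Implicit Arguments.
Unset Strict Implicit.
Unset Printing Implicit Defensive.

Import Order.TTheory GRing.Theory Num.Theory.
Import numFieldNormedType.Exports.

Local Open Scope classical_set_scope.
Local Open Scope ring_scope.

(* The configuration space A^I with the product topology, equipped with its
   Borel sigma-algebra.  The library's measurable types are pointed, hence the
   pointed alphabet: this loses nothing, since A is nonempty as soon as A^I
   carries a probability measure and I is inhabited. *)
Definition config (I : Type) (A : pdiscreteTopologicalType) :=
  g_sigma_algebraType (@open {ptws I -> A}).

Definition delta (R : realType) (I A : Type) (f : (I -> A) -> R) (j : I)
    : \bar R :=
  ereal_sup [set e | exists w w' : I -> A,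
    (forall i, i <> j -> w i = w' i) /\ e = `|f w - f w'|%:E].

Definition delta_norm2_fin (R : realType) (A : Type) (n : nat)
    (f : ('I_n -> A) -> R) : \bar R :=
  (\sum_(j < n) delta f j ^+ 2)%E.

Definition delta_norm2 (R : realType) (A : Type) (f : (nat -> A) -> R)
    : \bar R :=
  (\sum_(0 <= j <oo) delta f j ^+ 2)%E.

Definition var (R : realType) (A : Type) (f : (nat -> A) -> R) (n : nat)
    : \bar R :=
  ereal_sup [set e | exists w w' : nat -> A,
    (forall i, (i <= n)%N -> w i = w' i) /\ e = `|f w - f w'|%:E].

Definition UC (R : realType) (A : Type) : set ((nat -> A) -> R) :=
  [set f | var f n @[n --> \oo] --> 0%E].

Definition BC (R : realType) (A : pdiscreteTopologicalType)
    : set ({ptws nat -> A} -> R) :=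
  [set f | continuous f /\ bounded_fun f].

(* E_mu[exp(F - E_mu[F])] <= exp(C * s).  The inner expectation is finite for
   every F this is applied to (all of them are bounded and measurable). *)
Definition exp_moment_bound (R : realType) (I : Type)
    (A : pdiscreteTopologicalType) (mu : probability (config I A) R)
    (C : R) (F : config I A -> R) (s : \bar R) : Prop :=
  ('E_mu[fun w => expR (F w - fine 'E_mu[F])] <= expeR (C%:E * s))%E.

(* The index set I is nat or int, and iota : nat -> I is the inclusion through
   which functions of the coordinates 0, ..., n are viewed as functions on
   A^I. *)
Definition gaussian_concentration (R : realType) (I : Type)
    (A : pdiscreteTopologicalType) (iota : nat -> I)
    (mu : probability (config I A) R) (C : R) : Prop :=
  forall (n : nat) (f : ('I_n.+1 -> A) -> R),
    (forall j, (delta f j < +oo)%E) ->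
    exp_moment_bound mu C (fun w => f (fun i => w (iota i)))
      (delta_norm2_fin f).

(* Main.v *)
(* The bound passes to f through its approximations f_n, obtained by freezing
   all coordinates beyond n to a fixed letter.  Freezing does not increase the
   oscillations, so ||delta(f_n)||_2 <= ||delta(f)||_2, and |f - f_n| <= var_n(f)
   uniformly, so that the exponential moments of f - E f and of f_n - E f_n
   differ by a factor of at most exp(2 var_n(f)), which tends to 1. *)
Require Import Defs.
From mathcomp Require Import all_boot all_order all_algebra.
From mathcomp Require Import all_classical all_reals all_analysis.
From mathcomp Require Import measurable_realfun lra.

Import Order.TTheory GRing.Theory Num.Theory.
Import numFieldNormedType.Exports.

Local Open Scope classical_set_scope.
Local Open Scope ring_scope.

Set Implicit Arguments.
Unset Strict Implicit.
Unset Printing Implicit Defensive.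

Lemma continuous_ptws (T A : topologicalType) (J : Type)
    (g : T -> {ptws J -> A}) :
  (forall j, continuous (fun t => g t j)) -> continuous g.
Proof.
move=> cg t; apply/cvg_sup => j U [V [[W oW <-] WgN WU]].
apply: (filterS WU); apply: (cg j t).
exact: open_nbhs_nbhs.
Qed.

Lemma continuous_coord (A : topologicalType) (J : Type) (j : J) :
  continuous (fun w : {ptws J -> A} => w j).
Proof.
move=> w; have /cvg_sup/(_ j) cw : w --> w by apply: cvg_id.
by move=> U /(@initial_continuous _ _ (fun w : J -> A => w j)) /cw.
Qed.

(** Open intervals generate the Borel sets of [R], and their preimages under [F] are open, hence
    among the generators of the sigma-algebra of [config I A]. *)
Lemma continuous_measurable_config (R : realType) (I : Type)
    (A : pdiscreteTopologicalType) (F : {ptws I -> A} -> R) :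
  continuous F -> measurable_fun [set: config I A] (F : config I A -> R).
Proof.
move=> /continuousP cF.
apply: (measurability _ (RGenOpens.measurableE R)) => _ [_ [a [b ->]] <-].
by apply: sub_sigma_algebra; rewrite setTI; apply: cF; exact: interval_open.
Qed.

Lemma bounded_funP (R : realType) (T : Type) (f : T -> R) :
  bounded_fun f <-> exists M, forall x, `|f x| <= M.
Proof.
split.
  by move=> [M [_ Mf]]; exists (M + 1) => x; apply: Mf; rewrite ?ltrDl.
move=> [M fM]; exists M; split; first exact: num_real.
by move=> y My x _; exact: le_trans (fM x) (ltW My).
Qed.

Lemma bounded_Lfun1 (R : realType) (d : measure_display) (T : measurableType d)
    (P : probability T R) (F : T -> R) :
  measurable_fun setT F -> bounded_fun F -> F \in Lfun P 1.
Proof.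
move=> mF bF; apply/Lfun1_integrable.
apply: measurable_bounded_integrable => //.
by rewrite -ge0_fin_numE// fin_num_measure.
Qed.

(** The exponent changes by at most [2 * e]: one [e] from the pointwise gap between [F] and [G],
    another from the gap between their means. *)
Lemma expectation_exp_perturb (R : realType) (d : measure_display)
    (T : measurableType d) (P : probability T R) (F G : T -> R) (e : R) :
  measurable_fun setT F -> bounded_fun F ->
  measurable_fun setT G -> bounded_fun G ->
  (forall x, `|F x - G x| <= e) ->
  ('E_P[fun x => expR (F x - fine 'E_P[F])] <=
   (expR (2 * e))%:E * 'E_P[fun x => expR (G x - fine 'E_P[G])])%E.
Proof.
move=> mF bF mG bG FG.
have LF := bounded_Lfun1 P mF bF.
have LG := bounded_Lfun1 P mG bG.
have EGF : fine 'E_P[G] - fine 'E_P[F] <= e.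
  rewrite -lee_fin EFinB !fineK ?expectation_fin_num// -expectationB//.
  (* As [P] has mass 1, [e] is the expectation of a constant, and the pointwise bound on [G - F] can
     be integrated. *)
  rewrite -[leRHS](expectation_cst P) unlock; apply: le_integral => //.
  - by apply/Lfun1_integrable; rewrite rpredB.
  - by apply/Lfun1_integrable/bounded_Lfun1 => //; exact: bounded_cst.
  - move=> x _; rewrite lee_fin /=.
    by have := FG x; rewrite ler_norml => /andP[+ _]; lra.
have mexp (H : T -> R) (c : R) : measurable_fun setT H ->
    measurable_fun setT (fun x => (expR (H x - c))%:E).
  move=> mH; apply/measurable_EFinP; apply: measurableT_comp => //.
  exact: measurable_funB.
have exp_ge0 (H : T -> R) (c : R) x : (0 <= (expR (H x - c))%:E)%E.
  by rewrite lee_fin expR_ge0.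
move: EGF; rewrite unlock => EGF.
rewrite -ge0_integralZl ?lee_fin ?expR_ge0//; last exact: mexp.
apply: ge0_le_integral => //.
- exact: mexp.
- by apply: emeasurable_funM => //; exact: mexp.
move=> x _; rewrite -EFinM lee_fin -expRD ler_expR.
by have := FG x; rewrite ler_norml => /andP[_]; lra.
Qed.

(** A constant configuration compared with itself puts 0 in the set; the supremum of an empty set
    would be -oo. *)
Lemma delta_ge0 (R : realType) (I : Type) (A : pointedType) (f : (I -> A) -> R)
    (j : I) : (0 <= delta f j)%E.
Proof.
apply: ereal_sup_ubound; exists (fun=> point), (fun=> point).
by rewrite subrr normr0.
Qed.

Lemma delta_bounded (R : realType) (I A : Type) (f : (I -> A) -> R) (j : I) :
  bounded_fun f -> (delta f j < +oo)%E.
Proof.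
move=> /bounded_funP[M fM]; apply: (@le_lt_trans _ _ (M + M)%:E); last exact: ltry.
apply: ge_ereal_sup => _ [w [w' [_ ->]]].
by rewrite lee_fin (le_trans (ler_normB _ _))// lerD.
Qed.

(** The freezing map, with [point] as the fixed letter. It starts from finite words, so that
    composing [f] with it gives a candidate member of the class of local functions. *)
Definition extend (A : pointedType) (n : nat) (v : 'I_n -> A) : nat -> A :=
  fun i => if insub i is Some k then v k else point.

Lemma extend_ord (A : pointedType) (n : nat) (w : nat -> A) (i : nat) :
  (i < n)%N -> extend (fun k : 'I_n => w k) i = w i.
Proof. by move=> ltin; rewrite /extend insubT. Qed.

(** Words that differ only at [j] are filled up with the same letter, so their extensions still
    differ only at [j]: the left supremum runs over fewer pairs. *)
Lemma delta_extend (R : realType) (A : pointedType) (n : nat)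
    (f : (nat -> A) -> R) (j : 'I_n) :
  (delta (fun v : 'I_n -> A => f (extend v)) j <= delta f j)%E.
Proof.
apply: ereal_sup_le => _ [v [v' [vv' ->]]].
exists (extend v), (extend v'); split=> // i ij.
rewrite /extend; case: insubP => // k _ ki; apply: vv' => kj.
by apply: ij; rewrite -ki kj.
Qed.

Lemma delta_norm2_extend (R : realType) (A : pointedType) (n : nat)
    (f : (nat -> A) -> R) :
  (delta_norm2_fin (fun v : 'I_n -> A => f (extend v)) <= delta_norm2 f)%E.
Proof.
(* Squares are nonnegative, so the partial sum stays below the series; it is then compared term by
   term. *)
apply: (@le_trans _ _ (\sum_(0 <= j < n) delta f j ^+ 2)%E); last first.
  by apply: nneseries_lim_ge => j _ _; exact: sqre_ge0.
rewrite big_mkord; apply: lee_sum => j _.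
by rewrite lee_sqr ?delta_ge0// delta_extend.
Qed.

(** [var f n] asks for agreement at 0, ..., n, which is n + 1 coordinates; hence ['I_n.+1]. *)
Lemma var_extend (R : realType) (A : pointedType) (n : nat)
    (f : (nat -> A) -> R) (w : nat -> A) :
  (`|f w - f (extend (fun k : 'I_n.+1 => w k))|%:E <= var f n)%E.
Proof.
apply: ereal_sup_ubound; exists w, (extend (fun k : 'I_n.+1 => w k)).
by split=> // i lein; rewrite extend_ord.
Qed.

Lemma continuous_extend (A : pdiscreteTopologicalType) (I : Type)
    (iota : nat -> I) (n : nat) :
  continuous (fun w : {ptws I -> A} =>
    extend (fun k : 'I_n => w (iota k)) : {ptws nat -> A}).
Proof.
apply: continuous_ptws => i; rewrite /extend.
case: insubP => [k _ _|_]; first exact: continuous_coord.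
by have := @cst_continuous {ptws I -> A} A point; apply.
Qed.

(** Keeping [I] and [iota] abstract treats the one-sided and the two-sided configuration spaces by
    one argument. *)
Lemma gaussian_concentration_UC (R : realType) (I : Type)
    (A : pdiscreteTopologicalType) (iota : nat -> I)
    (mu : probability (config I A) R) (C : R) (f : (nat -> A) -> R) :
  0 <= C -> gaussian_concentration iota mu C ->
  UC f -> @BC R A f -> (delta_norm2 f < +oo)%E ->
  exp_moment_bound mu C (fun w => f (fun i => w (iota i))) (delta_norm2 f).
Proof.
move=> C0 gc ucf [cf bf] dfoo; rewrite /exp_moment_bound.
have df0 : (0 <= delta_norm2 f)%E.
  by apply: nneseries_ge0 => j _ _; exact: sqre_ge0.
set F := fun w : config I A => f (fun i => w (iota i)).
have boundF (h : config I A -> nat -> A) : bounded_fun (f \o h).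
  by have /bounded_funP[M fM] := bf; apply/bounded_funP; exists M => w; exact: fM.
have mF : measurable_fun setT F.
  apply: continuous_measurable_config => w.
  apply: (@continuous_comp _ _ _
    (fun w : {ptws I -> A} => (fun i => w (iota i)) : {ptws nat -> A}) f).
    by apply: continuous_ptws => j; exact: continuous_coord.
  exact: cf.
have approx e : 0 < e ->
    ('E_mu[fun w => expR (F w - fine 'E_mu[F])] <=
     (expR (2 * e))%:E * expeR (C%:E * delta_norm2 f))%E.
  move=> e0.
  have [n varn] : exists n, (var f n < e%:E)%E.
    have : \forall n \near \oo, (var f n < e%:E)%E.
      by apply: (ucf [set x | (x < e%:E)%E]); apply: open_ereal_lt'; rewrite lte_fin.
    by case=> N _ varN; exists N; apply: varN => /=.
  pose G w := f (extend (fun k : 'I_n.+1 => w (iota k))).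
  have mG : measurable_fun setT (G : config I A -> R).
    apply: continuous_measurable_config => w.
    apply: (@continuous_comp _ _ _ (fun w : {ptws I -> A} =>
      extend (fun k : 'I_n.+1 => w (iota k)) : {ptws nat -> A}) f).
      exact: continuous_extend.
    exact: cf.
  apply: le_trans
    (expectation_exp_perturb mu mF (boundF _) mG (boundF _) (e := e) _) _.
    move=> w; rewrite -lee_fin.
    exact: le_trans (var_extend _ _ (fun i => w (iota i))) (ltW varn).
  rewrite lee_pmul2l ?lte_fin ?expR_gt0//.
  apply: le_trans (gc n (fun v => f (extend v)) _) _.
    by move=> j; apply: le_lt_trans (delta_extend _ _) _; exact: delta_bounded.
  rewrite lee_expeR; apply: lee_wpmul2l; first by rewrite lee_fin.
  exact: delta_norm2_extend.
move: approx; have /fineK <- : delta_norm2 f \is a fin_num.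
  by rewrite ge0_fin_numE.
rewrite -EFinM /=; set s := C * _; set E := ('E_mu[_])%E => approx.
apply/lee_addgt0Pr => eps eps0.
have d0 : 0 < eps / expR s by rewrite divr_gt0 ?expR_gt0.
(* This [e] solves [expR (2 * e) * expR s = expR s + eps]. *)
apply: le_trans (approx (ln (1 + eps / expR s) / 2) _) _.
  by rewrite divr_gt0// ln_gt0// ltrDl.
rewrite -EFinM -EFinD lee_fin mulrCA divff// mulr1 lnK ?qualifE /= ?addr_gt0//.
by rewrite mulrDl mul1r divfK ?lt0r_neq0 ?expR_gt0.
Qed.

Theorem theorem3p7 (R : realType) (A : pdiscreteTopologicalType)
    (hA : countable [set: A]%classic) (C : R) (hC : (0 < C)%R) :
  (forall mu : probability (config nat A) R,
     gaussian_concentration id mu C ->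
     forall f : (nat -> A) -> R,
       (@UC R A `&` @BC R A)%classic f ->
       (delta_norm2 f < +oo)%E ->
       exp_moment_bound mu C f (delta_norm2 f)) /\
  (forall mu : probability (config int A) R,
     gaussian_concentration Posz mu C ->
     forall f : (nat -> A) -> R,
       (@UC R A `&` @BC R A)%classic f ->
       (delta_norm2 f < +oo)%E ->
       exp_moment_bound mu C (fun w => f (fun i : nat => w (Posz i)))
         (delta_norm2 f)).
Proof.
by split=> mu gc f [ucf bcf] df;
  apply: gaussian_concentration_UC => //; exact: ltW.
Qed.
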